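(* There is no finite non-nilpotent group $G$ with a nontrivial normal subgroup $N\leq G$ such that $G/N$ is non-nilpotent and the graphs $\mathfrak{N}_G$ and $\mathfrak{N}_{G/N}$ are isomorphic.
   Context: For a group $G$, $nil(G)=\{x\in G \mid \langle x,y\rangle \text{ is nilpotent for all } y\in G\}$. The graph $\mathfrak{N}_G$ is the simple graph with vertex set $G\setminus nil(G)$ in which two distinct vertices $x,y$ are adjacent if and only if $\langle x,y\rangle$ is not nilpotent. *)

(* Defs.v *)
From HB Require Import structures.
From mathcomp Require Import all_boot all_fingroup all_solvable.

Set Implicit Arguments.
Unset Strict Implicit.
Unset Printing Implicit Defensive.

Local Open Scope group_scope.

Record sgraph := SGraph {
  vertex : finType;
  adj : rel vertex;
  adj_sym : symmetric adj;
  adj_irrefl : irreflexive adj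
}.

Definition graph_isom (A B : sgraph) : Prop :=
  exists2 f : vertex A -> vertex B, bijective f &
    forall x y : vertex A, adj (f x) (f y) = adj x y.

Section NonNilpotentGraph.

Variables (gT : finGroupType) (G : {group gT}).

Definition nil_set : {set gT} :=
  [set x in G | [forall y in G, nilpotent <<[set x; y]>>]].

(* The vertices form the subtype of gT carved out by G :\: nil_set. *)
Definition nn_vertex : finType := {x : gT | x \in G :\: nil_set}.

Definition nn_adj : rel nn_vertex :=
  fun x y => (x != y) && ~~ nilpotent <<[set val x; val y]>>.

Lemma nn_adj_sym : symmetric nn_adj.
Proof. by move=> x y; rewrite /nn_adj eq_sym setUC. Qed.

Lemma nn_adj_irrefl : irreflexive nn_adj.
Proof. by move=> x; rewrite /nn_adj eqxx. Qed.

Definition nn_graph : sgraph := SGraph nn_adj_sym nn_adj_irrefl.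

End NonNilpotentGraph.

(* Main.v *)
Require Import Defs.
From HB Require Import structures.
From mathcomp Require Import all_boot all_fingroup all_solvable.

(** If [xN] and [yN] generate a non-nilpotent group, so do [xn] and [y] for
    every [n \in N]; hence the quotient map sends the vertices over the vertices
    of the graph of [G / N] onto them with fibres of size [#|N| > 1]. As the
    graph of a non-nilpotent group has a vertex, by the Baer-Suzuki theorem, the
    graph of [G] has strictly more vertices than that of [G / N]. *)

Set Implicit Arguments.
Unset Strict Implicit.
Unset Printing Implicit Defensive.

Local Open Scope group_scope.

Lemma nilpotent_2gen (gT : finGroupType) (G : {group gT}) :
  {in G &, forall x y, nilpotent <<[set x; y]>>} -> nilpotent G.
Proof.
move=> nil2; apply: nilpotentS (Fitting_nil G).
apply/subsetP=> x Gx; rewrite -(prod_constt x).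
apply: group_prod => p _.
have Gxp: x.`_p \in G by rewrite groupX.
have sOF: 'O_p(G) \subset 'F(G).
  by rewrite Fitting_max ?pcore_normal ?(pgroup_nil (pcore_pgroup _ _)).
apply: (subsetP sOF); apply: Baer_Suzuki => // y Gy.
have nilH := nil2 _ _ Gxp (groupJ Gxp Gy).
(* The p-core of a nilpotent group is its Hall p-subgroup and contains all its p-elements, here both
   generators. *)
apply: pgroupS (pcore_pgroup p <<[set x.`_p; x.`_p ^ y]>>).
have hallO := nilpotent_pcore_Hall p nilH.
rewrite gen_subG; apply/subsetP=> z Xz.
rewrite (mem_normal_Hall hallO) ?pcore_normal ?mem_gen //.
by case/set2P: Xz => ->; rewrite ?p_eltJ p_elt_constt.
Qed.

Lemma nn_vertexP (gT : finGroupType) (G : {group gT}) x :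
  reflect (x \in G /\ exists2 y, y \in G & ~~ nilpotent <<[set x; y]>>)
          (x \in G :\: nil_set G).
Proof.
rewrite !inE andbC; case: (boolP (x \in G)) => Gx /=; last by right; case.
rewrite negb_forall; apply: (iffP existsP) => [[y]|[_ [y Gy nnil]]].
  by rewrite negb_imply => /andP[Gy nnil]; split=> //; exists y.
by exists y; rewrite negb_imply Gy.
Qed.

Lemma card_nn_vertex (gT : finGroupType) (G : {group gT}) :
  #|nn_vertex G| = #|G :\: nil_set G|.
Proof. by rewrite card_sig; apply: eq_card => x; rewrite inE. Qed.

Lemma nn_vertex_exists (gT : finGroupType) (G : {group gT}) :
  ~~ nilpotent G -> exists x, x \in G :\: nil_set G.
Proof.
move=> nnilG; apply/set0Pn; apply: contraNneq nnilG => V0.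
apply: nilpotent_2gen => x y Gx Gy; apply: contraT => nnil.
suff: x \in G :\: nil_set G by rewrite V0 inE.
by apply/nn_vertexP; split=> //; exists y.
Qed.

(** A witness for [coset N x] lifts to some [y] in [G]: were [<<[set x; y]>>] nilpotent, its image,
    generated by the two cosets, would be too. *)
Lemma nn_vertex_coset (gT : finGroupType) (G N : {group gT}) x :
    N <| G -> x \in G -> coset N x \in G / N :\: nil_set (G / N) ->
  x \in G :\: nil_set G.
Proof.
move=> /andP[_ nNG] Gx /nn_vertexP[_ [_ /morphimP[y Ny Gy ->] nnil]].
apply/nn_vertexP; split=> //; exists y => //; apply: contra nnil => nilxy.
have sxyN: [set x; y] \subset 'N(N).
  by rewrite subUset !sub1set Ny (subsetP nNG).
have := quotient_nil N nilxy; rewrite /quotient morphim_gen // morphimU.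
by rewrite !morphim_set1 // (subsetP nNG).
Qed.

Lemma ltn_card_nn_vertex (gT : finGroupType) (G N : {group gT}) :
    N <| G -> N :!=: 1 -> ~~ nilpotent (G / N) ->
  #|nn_vertex (G / N)| < #|nn_vertex G|.
Proof.
move=> nsNG ntN nnilGN; have [sNG nNG] := andP nsNG; rewrite !card_nn_vertex.
set V := G :\: nil_set G; set W := _ :\: nil_set _.
have sWV: W \subset coset N @: V.
  apply/subsetP=> _ /[dup] /setDP[/morphimP[x _ Gx ->] _] Wx.
  by rewrite imset_f // (nn_vertex_coset nsNG).
apply: leq_ltn_trans (subset_leq_card sWV) _.
(* Equality of the cardinals would make [coset N] injective on [V]; the vertices [x] and [n * x],
   with [n] in [N] nontrivial, refute this. *)
rewrite ltn_neqAle leq_imset_card andbT; apply/negP => /imset_injP injV.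
have [_ /[dup] /setDP[/morphimP[x Nx Gx ->] _] Wx] := nn_vertex_exists nnilGN.
have [n Nn nt_n] := trivgPn _ ntN.
have eq_nx: coset N (n * x) = coset N x.
  by rewrite morphM //= ?(subsetP (normG N)) // coset_id // mul1g.
have Gnx: n * x \in G by rewrite groupM // (subsetP sNG).
have Vnx: n * x \in V by apply: nn_vertex_coset nsNG Gnx _; rewrite eq_nx.
have /eqP := injV _ _ Vnx (nn_vertex_coset nsNG Gx Wx) eq_nx.
by rewrite eq_mulgV1 mulgK (negPf nt_n).
Qed.

Theorem proposition4p10 :
  ~ exists (gT : finGroupType) (G N : {group gT}),
      [/\ ~~ nilpotent G,
          N <| G,
          N :!=: 1,
          ~~ nilpotent (G / N) &
          graph_isom (nn_graph G) (nn_graph (G / N))].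
Proof.
move=> [gT [G [N [_ nsNG ntN nnilGN [f bij_f _]]]]].
have := ltn_card_nn_vertex nsNG ntN nnilGN.
by rewrite -(bij_eq_card bij_f) ltnn.
Qed.
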